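(* Let $n\ge 3$ be an integer, and let $G=\mathbb{F}_2^{n-1}\rtimes_\varphi D_{2n}$ and $\rho_0,\rho_1,\rho_2\in G$ be as defined in the context. Then $(G,\{\rho_0,\rho_1,\rho_2\})$ admits the presentation $$G=\left\langle \rho_0,\rho_1,\rho_2\ \middle|\ \begin{array}{l}\rho_0^2=\rho_1^2=\rho_2^2=(\rho_0\rho_2)^2=(\rho_0\rho_1)^n=(\rho_1\rho_2)^n=1,\\ \left((\rho_1\rho_2)^k(\rho_0\rho_1)^k\right)^2=1\ \text{ for } 1\le k\le n-1\end{array}\right\rangle .$$ That is, the elements $\rho_0,\rho_1,\rho_2$ generate $G$ and satisfy these relations, and the induced homomorphism onto $G$ from the abstract group with this presentation is an isomorphism.
   Context: Let $U=(U_{ij})$ and $V=(V_{ij})$ be the $(n-1)\times(n-1)$ matrices over $\mathbb{F}_2$ given by: for $1\le i\le n-2$, $U_{ij}=1$ if $i+j=n-1$ and $U_{ij}=0$ otherwise, and $U_{n-1,j}=1$ for all $j$; $V_{ij}=1$ if $i+j=n$ and $V_{ij}=0$ otherwise. Let $D_{2n}=\langle h_0,h_1\mid h_0^2=h_1^2=(h_0h_1)^n=e\rangle$ be the dihedral group of order $2n$, and let $\varphi:D_{2n}\to\mathrm{GL}(n-1,\mathbb{F}_2)$ be the (faithful) homomorphism with $\varphi(h_0)=U$, $\varphi(h_1)=V$. With $\mathbb{F}_2^{n-1}$ regarded as column vectors, $G=\mathbb{F}_2^{n-1}\rtimes_\varphi D_{2n}$ is the set of pairs $(\mathbf{a},x)$,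 $\mathbf{a}\in\mathbb{F}_2^{n-1}$, $x\in D_{2n}$, with multiplication $(\mathbf{a},x)(\mathbf{b},y)=(\mathbf{a}+\varphi(x)\mathbf{b},\,xy)$. Put $\rho_0=(\mathbf{0},h_0)$, $\rho_1=(\mathbf{0},h_1)$, $\rho_2=((0,\dots,0,1)^\top,h_0)$. *)

(* Defs.v *)
From HB Require Import structures.
From mathcomp Require Import all_boot all_order all_algebra.
From mathcomp Require Import zify.
From mathcomp Require Import boolp classical_sets.

Set Implicit Arguments.
Unset Strict Implicit.
Unset Printing Implicit Defensive.

Import Algebra.
Local Open Scope group_scope.

(* {gmorphism G -> H}: homomorphisms of (possibly infinite) groups. *)
Notation "{ 'gmorphism' G -> H }" := (UMagmaMorphism.type G H)
  (at level 0, G at level 98, H at level 99,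
   format "{ 'gmorphism'  G  ->  H }") : type_scope.

Section Subgroups.
Variable G : groupType.

Definition subgroup : set (set G) :=
  [set H | H 1 /\ forall x y, H x -> H y -> H (x * y^-1)].

Definition normal_subgroup : set (set G) :=
  [set H | subgroup H /\ forall x y, H x -> H (x ^ y)].

Definition generates (A : set G) : Prop := smallest subgroup A = setT.

Definition normal_closure (R : set G) : set G := smallest normal_subgroup R.

Lemma normal_closureP (R : set G) : normal_subgroup (normal_closure R).
Proof.
split; first split.
- by move=> H [[[H1 _] _] _].
- move=> x y xR yR H HR; case: (HR) => -[[_ HF] _] _.
  by apply: HF; [apply: xR | apply: yR].
- by move=> x y xR H HR; case: (HR) => -[_ HJ] _; apply: HJ; apply: xR.
Qed.

Lemma sub_normal_closure (R : set G) : (R `<=` normal_closure R)%classic.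
Proof. by move=> x Rx H [_ RH]; apply: RH. Qed.

End Subgroups.

Section FreeGroup.
Variable X : choiceType.

(* The letter (x, true) stands for x, and (x, false) for its inverse. *)
Definition word := seq (X * bool).

Inductive word_eq : word -> word -> Prop :=
| word_eq_refl u : word_eq u u
| word_eq_sym u v : word_eq u v -> word_eq v u
| word_eq_trans u v w : word_eq u v -> word_eq v w -> word_eq u w
| word_eq_cancel u x b v : word_eq (u ++ [:: (x, b), (x, ~~ b) & v]) (u ++ v).

Lemma word_eq_cat u u' v v' :
  word_eq u u' -> word_eq v v' -> word_eq (u ++ v) (u' ++ v').
Proof.
move=> uu' vv'; apply: (@word_eq_trans _ (u' ++ v)).
  elim: uu' => {u u'} [u|u u' _|u u' w _ IH _|u x b w].
  - exact: word_eq_refl.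
  - exact: word_eq_sym.
  - exact: word_eq_trans IH.
  - by rewrite -!catA; apply: word_eq_cancel.
elim: vv' => {v v'} [v|v v' _|v v' w _ IH _|v x b w].
- exact: word_eq_refl.
- exact: word_eq_sym.
- exact: word_eq_trans IH.
- by rewrite !catA; apply: word_eq_cancel.
Qed.

Definition word_inv (u : word) : word := rev [seq (p.1, ~~ p.2) | p <- u].

Lemma word_inv_cat u v : word_inv (u ++ v) = word_inv v ++ word_inv u.
Proof. by rewrite /word_inv map_cat rev_cat. Qed.

Lemma word_invK : involutive word_inv.
Proof.
move=> u; rewrite /word_inv map_rev revK -map_comp -[RHS]map_id.
by apply: eq_map => -[x b] /=; rewrite negbK.
Qed.

Lemma word_eq_inv u v : word_eq u v -> word_eq (word_inv u) (word_inv v).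
Proof.
elim=> {u v} [u|u v _|u v w _ IH _|u x b v].
- exact: word_eq_refl.
- exact: word_eq_sym.
- exact: word_eq_trans IH.
rewrite -[[:: _, _ & v]]/([:: (x, b); (x, ~~ b)] ++ v) !word_inv_cat -catA.
by rewrite /word_inv /= -{2}[b]negbK; apply: word_eq_cancel.
Qed.

Lemma word_eqVg u : word_eq (word_inv u ++ u) [::].
Proof.
elim: u => [|[x b] u IH]; first exact: word_eq_refl.
rewrite -cat1s word_inv_cat -catA; apply: word_eq_trans IH.
by rewrite /= -{2}[b]negbK; apply: word_eq_cancel.
Qed.

Definition word_eqb (u v : word) : bool := `[< word_eq u v >].

Fact word_eqb_refl : reflexive word_eqb.
Proof. by move=> u; apply/asboolP; apply: word_eq_refl. Qed.

Fact word_eqb_sym : symmetric word_eqb.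
Proof. by move=> u v; apply/asboolP/asboolP; apply: word_eq_sym. Qed.

Fact word_eqb_trans : transitive word_eqb.
Proof.
by move=> v u w /asboolP uv /asboolP vw; apply/asboolP; apply: word_eq_trans vw.
Qed.

Canonical word_equiv :=
  EquivRel word_eqb word_eqb_refl word_eqb_sym word_eqb_trans.

Local Open Scope quotient_scope.

Definition free_group := {eq_quot word_equiv}.
HB.instance Definition _ := Choice.on free_group.

Definition word_class (u : word) : free_group := \pi_({eq_quot word_equiv}) u.
Definition word_repr (g : free_group) : word := repr (g : {eq_quot word_equiv}).

Lemma word_reprK : cancel word_repr word_class.
Proof. exact: reprK. Qed.

Lemma word_classP u v : word_class u = word_class v <-> word_eq u v.
Proof.
by split=> [/eqmodP/asboolP|uv]; last by apply/eqmodP/asboolP.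
Qed.

Lemma word_repr_eq u : word_eq (word_repr (word_class u)) u.
Proof. by apply/word_classP; rewrite word_reprK. Qed.

Definition free_mul (g h : free_group) := word_class (word_repr g ++ word_repr h).
Definition free_one := word_class [::].
Definition free_inv (g : free_group) := word_class (word_inv (word_repr g)).

Lemma free_mulE u v : free_mul (word_class u) (word_class v) = word_class (u ++ v).
Proof. by apply/word_classP/word_eq_cat; apply: word_repr_eq. Qed.

Lemma free_invE u : free_inv (word_class u) = word_class (word_inv u).
Proof. by apply/word_classP/word_eq_inv; apply: word_repr_eq. Qed.

Fact free_mulA : associative free_mul.
Proof.
move=> g h k; rewrite -[g]word_reprK -[h]word_reprK -[k]word_reprK.
by rewrite !free_mulE catA.
Qed.

Fact free_mul1 : left_id free_one free_mul.
Proof. by move=> g; rewrite -[g]word_reprK /free_one free_mulE. Qed.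

Fact free_mulg1 : right_id free_one free_mul.
Proof. by move=> g; rewrite -[g]word_reprK /free_one free_mulE cats0. Qed.

Fact free_mulV : left_inverse free_one free_inv free_mul.
Proof.
move=> g; rewrite -[g]word_reprK free_invE free_mulE.
by apply/word_classP/word_eqVg.
Qed.

Fact free_mulgV : right_inverse free_one free_inv free_mul.
Proof.
move=> g; rewrite -[g]word_reprK free_invE free_mulE.
apply/word_classP; rewrite -{1}(word_invK (word_repr g)).
exact: word_eqVg.
Qed.

HB.instance Definition _ := isGroup.Build free_group
  free_mulA free_mul1 free_mulg1 free_mulV free_mulgV.

Definition free_gen (x : X) : free_group := word_class [:: (x, true)].

End FreeGroup.

Section FreeLift.
Variables (X : choiceType) (G : groupType) (f : X -> G).

Definition word_eval (u : word X) : G :=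
  \prod_(p <- u) (if p.2 then f p.1 else (f p.1)^-1).

Lemma word_eval_eq u v : word_eq u v -> word_eval u = word_eval v.
Proof.
elim=> {u v} [//|u v _ -> //|u v w _ -> _ -> //|u x b v].
rewrite /word_eval !big_cat /= !big_cons /=; congr (_ * _).
by case: b => /=; rewrite ?mulKg ?mulVKg.
Qed.

Definition free_lift (g : free_group X) : G := word_eval (word_repr g).

Lemma free_liftE u : free_lift (word_class u) = word_eval u.
Proof. by apply: word_eval_eq; apply: word_repr_eq. Qed.

Fact free_lift_monoid_morphism : monoid_morphism free_lift.
Proof.
split=> [|g h]; first by rewrite free_liftE /word_eval big_nil.
rewrite -[g]word_reprK -[h]word_reprK [_ * _]free_mulE !free_liftE.
by rewrite /word_eval big_cat.
Qed.

HB.instance Definition _ :=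
  isUMagmaMorphism.Build _ _ free_lift free_lift_monoid_morphism.

Lemma free_lift_gen x : free_lift (free_gen x) = f x.
Proof. by rewrite free_liftE /word_eval big_seq1. Qed.

End FreeLift.

(* The group < X | R >, i.e. the free group on X modulo the normal closure    *)
(* of the set R of relators.                                                  *)
Section Presented.
Variables (X : choiceType) (R : set (free_group X)).

Definition pres_eqb (g h : free_group X) : bool :=
  `[< normal_closure R (g^-1 * h) >].

Let N1 : normal_closure R 1.
Proof. by have [[]] := normal_closureP R. Qed.

Let NV g : normal_closure R g -> normal_closure R g^-1.
Proof.
by move=> Ng; have [[_ NF] _] := normal_closureP R; rewrite -div1g; apply: NF.
Qed.

Let NM g h :
  normal_closure R g -> normal_closure R h -> normal_closure R (g * h).
Proof.
move=> Ng Nh; have [[_ NF] _] := normal_closureP R.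
by rewrite -[h]invgK; apply: NF => //; apply: NV.
Qed.

Let NJ g h : normal_closure R g -> normal_closure R (g ^ h).
Proof. by move=> Ng; have [_] := normal_closureP R; apply. Qed.

Fact pres_eqb_refl : reflexive pres_eqb.
Proof. by move=> g; apply/asboolP; rewrite mulVg. Qed.

Fact pres_eqb_sym : symmetric pres_eqb.
Proof.
by move=> g h; apply/asboolP/asboolP => /NV; rewrite invgM invgK.
Qed.

Fact pres_eqb_trans : transitive pres_eqb.
Proof.
move=> h g k /asboolP gh /asboolP hk; apply/asboolP.
by have := NM gh hk; rewrite -mulgA mulVKg.
Qed.

Canonical pres_equiv :=
  EquivRel pres_eqb pres_eqb_refl pres_eqb_sym pres_eqb_trans.

Local Open Scope quotient_scope.

Definition presented := {eq_quot pres_equiv}.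
HB.instance Definition _ := Choice.on presented.

Definition pres_class (g : free_group X) : presented := \pi_({eq_quot pres_equiv}) g.
Definition pres_repr (p : presented) : free_group X := repr (p : {eq_quot pres_equiv}).

Lemma pres_reprK : cancel pres_repr pres_class.
Proof. exact: reprK. Qed.

Lemma pres_classP g h :
  pres_class g = pres_class h <-> normal_closure R (g^-1 * h).
Proof. by split=> [/eqmodP/asboolP|gh]; last by apply/eqmodP/asboolP. Qed.

Lemma pres_repr_eq g : normal_closure R ((pres_repr (pres_class g))^-1 * g).
Proof. by apply/pres_classP; rewrite pres_reprK. Qed.

Definition pres_mul (p q : presented) := pres_class (pres_repr p * pres_repr q).
Definition pres_one := pres_class 1.
Definition pres_inv (p : presented) := pres_class (pres_repr p)^-1.

Lemma pres_mulE g h : pres_mul (pres_class g) (pres_class h) = pres_class (g * h).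
Proof.
apply/pres_classP.
move: (pres_repr_eq g) (pres_repr_eq h).
set g' := pres_repr _; set h' := pres_repr _ => Ng Nh.
have -> : (g' * h')^-1 * (g * h) = (g'^-1 * g) ^ h' * (h'^-1 * h).
  by rewrite conjgE invgM -!mulgA mulVKg.
by apply: NM => //; apply: NJ.
Qed.

Lemma pres_invE g : pres_inv (pres_class g) = pres_class g^-1.
Proof.
apply/pres_classP; move: (pres_repr_eq g); set g' := pres_repr _ => Ng.
have -> : g'^-1^-1 * g^-1 = ((g'^-1 * g)^-1) ^ g'^-1.
  by rewrite conjgE invgM !invgK -!mulgA mulgV mulg1.
by apply: NJ; apply: NV.
Qed.

Fact pres_mulA : associative pres_mul.
Proof.
move=> p q r; rewrite -[p]pres_reprK -[q]pres_reprK -[r]pres_reprK.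
by rewrite !pres_mulE mulgA.
Qed.

Fact pres_mul1 : left_id pres_one pres_mul.
Proof. by move=> p; rewrite -[p]pres_reprK /pres_one pres_mulE mul1g. Qed.

Fact pres_mulg1 : right_id pres_one pres_mul.
Proof. by move=> p; rewrite -[p]pres_reprK /pres_one pres_mulE mulg1. Qed.

Fact pres_mulV : left_inverse pres_one pres_inv pres_mul.
Proof. by move=> p; rewrite -[p]pres_reprK pres_invE pres_mulE mulVg. Qed.

Fact pres_mulgV : right_inverse pres_one pres_inv pres_mul.
Proof. by move=> p; rewrite -[p]pres_reprK pres_invE pres_mulE mulgV. Qed.

HB.instance Definition _ := isGroup.Build presented
  pres_mulA pres_mul1 pres_mulg1 pres_mulV pres_mulgV.

Definition pres_gen (x : X) : presented := pres_class (free_gen x).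

Section PresLift.
Variables (G : groupType) (f : X -> G).
Hypothesis fR : forall r, R r -> free_lift f r = 1.

(* The phantom first argument is what makes pres_lift well defined.           *)
Definition pres_lift (_ : forall r, R r -> free_lift f r = 1) (p : presented) : G :=
  free_lift f (pres_repr p).

Lemma free_lift_normal_closure g : normal_closure R g -> free_lift f g = 1.
Proof.
move/(_ [set h | free_lift f h = 1]%classic); apply; split=> //.
split; first split.
- exact: gmulf1.
- by move=> x y /= fx fy; rewrite gmulfM gmulfV /= fx fy mulgV.
- by move=> x y /= fx; rewrite gmulfJ /= fx conj1g.
Qed.

Lemma pres_liftE g : pres_lift fR (pres_class g) = free_lift f g.
Proof.
have /free_lift_normal_closure := pres_repr_eq g.
rewrite gmulfM gmulfV => /eqP; rewrite mulg_eq1 => /eqP/invg_inj.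
by rewrite /pres_lift => ->.
Qed.

Fact pres_lift_monoid_morphism : monoid_morphism (pres_lift fR).
Proof.
split=> [|p q]; first by rewrite pres_liftE gmulf1.
rewrite -[p]pres_reprK -[q]pres_reprK [_ * _]pres_mulE !pres_liftE.
exact: gmulfM.
Qed.

HB.instance Definition _ :=
  isUMagmaMorphism.Build _ _ (pres_lift fR) pres_lift_monoid_morphism.

Lemma pres_lift_gen x : pres_lift fR (pres_gen x) = f x.
Proof. by rewrite pres_liftE free_lift_gen. Qed.

End PresLift.
End Presented.

(* The family f generates G, satisfies the relators R, and the induced        *)
(* homomorphism < X | R > -> G is an isomorphism.                             *)
Definition admits_presentation (G : groupType) (X : choiceType) (f : X -> G)
    (R : set (free_group X)) : Prop :=
  generates (range f) /\
  exists fR : forall r, R r -> free_lift f r = 1, bijective (pres_lift fR).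

(* The library's {'GL_d[F]} consists of matrices of size d.-1.+1 over a       *)
(* finite ring; this is GL(d, F) for arbitrary d, with genuine d x d matrices.*)
Section GeneralLinear.
Variables (F : fieldType) (d : nat).

Definition GL := {A : 'M[F]_d | A \in unitmx}.
HB.instance Definition _ := Choice.on GL.

Definition GL_mul (A B : GL) : GL :=
  exist _ (val A *m val B)%R
    (etrans (unitmx_mul _ _) (introT andP (conj (valP A) (valP B)))).
Definition GL_one : GL := exist _ (1%:M)%R (unitmx1 _ _).
Definition GL_inv (A : GL) : GL :=
  exist _ (invmx (val A)) (etrans (unitmx_inv _) (valP A)).

Fact GL_mulA : associative GL_mul.
Proof. by move=> A B C; apply: val_inj; apply: mulmxA. Qed.
Fact GL_mul1 : left_id GL_one GL_mul.
Proof. by move=> A; apply: val_inj; apply: mul1mx. Qed.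
Fact GL_mulg1 : right_id GL_one GL_mul.
Proof. by move=> A; apply: val_inj; apply: mulmx1. Qed.
Fact GL_mulV : left_inverse GL_one GL_inv GL_mul.
Proof. by move=> A; apply: val_inj; apply: mulVmx (valP A). Qed.
Fact GL_mulgV : right_inverse GL_one GL_inv GL_mul.
Proof. by move=> A; apply: val_inj; apply: mulmxV (valP A). Qed.

HB.instance Definition _ :=
  isGroup.Build GL GL_mulA GL_mul1 GL_mulg1 GL_mulV GL_mulgV.

Lemma val_GLM (A B : GL) : val (A * B) = (val A *m val B)%R.
Proof. by []. Qed.

Lemma val_GL1 : val (1 : GL) = (1%:M)%R.
Proof. by []. Qed.

Lemma val_GLV (A : GL) : val A^-1 = invmx (val A).
Proof. by []. Qed.

End GeneralLinear.

(* F^d ><|_phi D, with F^d the column vectors; phi is a phantom argument of    *)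
(* the carrier, on which the group structure depends.                         *)
Section SemidirectProduct.
Variables (F : fieldType) (d : nat) (D : groupType).
Variable phi : {gmorphism D -> GL F d}.

Definition semidirect of {gmorphism D -> GL F d} := ('cV[F]_d * D)%type.
HB.instance Definition _ := Choice.on (semidirect phi).

Definition sd_mul (g h : semidirect phi) : semidirect phi :=
  ((g.1 + val (phi g.2) *m h.1)%R, g.2 * h.2).
Definition sd_one : semidirect phi := (0%R, 1).
Definition sd_inv (g : semidirect phi) : semidirect phi :=
  ((- (val (phi (g.2^-1)%g) *m g.1))%R, g.2^-1).

Fact sd_mulA : associative sd_mul.
Proof.
move=> [a x] [b y] [c z]; congr (_, _); rewrite /= ?mulgA //.
by rewrite gmulfM val_GLM mulmxDr mulmxA GRing.addrA.
Qed.
Fact sd_mul1 : left_id sd_one sd_mul.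
Proof.
by move=> [a x]; congr (_, _); rewrite /= ?mul1g // gmulf1 mul1mx GRing.add0r.
Qed.
Fact sd_mulg1 : right_id sd_one sd_mul.
Proof.
by move=> [a x]; congr (_, _); rewrite /= ?mulg1 // mulmx0 GRing.addr0.
Qed.
Fact sd_mulV : left_inverse sd_one sd_inv sd_mul.
Proof.
by move=> [a x]; congr (_, _); rewrite /= ?mulVg // GRing.addNr.
Qed.
Fact sd_mulgV : right_inverse sd_one sd_inv sd_mul.
Proof.
move=> [a x]; congr (_, _); rewrite /= ?mulgV //.
by rewrite mulmxN mulmxA -val_GLM -gmulfM mulgV gmulf1 mul1mx GRing.subrr.
Qed.

HB.instance Definition _ := isGroup.Build (semidirect phi)
  sd_mulA sd_mul1 sd_mulg1 sd_mulV sd_mulgV.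

End SemidirectProduct.

Section Dihedral.
Variable n : nat.

Let x0 : free_group 'I_2 := free_gen (@Ordinal 2 0 isT).
Let x1 : free_group 'I_2 := free_gen (@Ordinal 2 1 isT).

Definition dihedral_relators : set (free_group 'I_2) :=
  [set x0 ^+ 2; x1 ^+ 2; (x0 * x1) ^+ n]%classic.

(* D_{2n} = < h0, h1 | h0^2 = h1^2 = (h0 h1)^n = 1 >                           *)
Definition dihedral : groupType := presented dihedral_relators.

Definition h0 : dihedral := pres_gen _ (@Ordinal 2 0 isT).
Definition h1 : dihedral := pres_gen _ (@Ordinal 2 1 isT).

End Dihedral.

Section MatricesUV.
Local Open Scope ring_scope.

(* Ordinals start at 0: the 1-based indices of the row i and the column j are *)
(* i.+1 and j.+1.                                                             *)
Definition Umx (n : nat) : 'M['F_2]_(n.-1) :=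
  \matrix_(i, j) (if (i.+1 == n.-1)%N then 1 else (i.+1 + j.+1 == n.-1)%N%:R).

Definition Vmx (n : nat) : 'M['F_2]_(n.-1) :=
  \matrix_(i, j) (i.+1 + j.+1 == n)%N%:R.

(* U and V permute the n coordinates (v_1, ..., v_{n-1}, v_1 + ... + v_{n-1})  *)
(* of v as reflections of a regular n-gon.                                    *)
Let ext d (v : 'cV['F_2]_d) (k : nat) : 'F_2 :=
  if insub k is Some i then v i 0 else \sum_i v i 0.

Let ext_lt d (v : 'cV['F_2]_d) (i : 'I_d) : ext v i = v i 0.
Proof. by rewrite /ext valK. Qed.

Let ext_ge d (v : 'cV['F_2]_d) k : (d <= k)%N -> ext v k = \sum_i v i 0.
Proof. by move=> dk; rewrite /ext insubF // ltnNge dk. Qed.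

Let ext_inj d (v w : 'cV['F_2]_d) :
  (forall k, (k <= d)%N -> ext v k = ext w k) -> v = w.
Proof.
move=> vw; apply/colP => i; rewrite -!ext_lt; apply: vw.
exact: ltnW.
Qed.

Let F2_addrr (x : 'F_2) : x + x = 0.
Proof. by case: x => [[|[|m]] //] lt_m; apply: val_inj. Qed.

Let VmxE d (v : 'cV['F_2]_d) i : (Vmx d.+1 *m v) i 0 = v (rev_ord i) 0.
Proof.
rewrite mxE (bigD1 (rev_ord i)) //= big1 ?GRing.addr0 => [|j /eqP ji].
  have e : (i.+1 + (d - i.+1).+1 == d.+1)%N by have := ltn_ord i; lia.
  by rewrite mxE /= e GRing.mul1r.
rewrite mxE; case: eqP => [/= e|_]; last by rewrite GRing.mul0r.
by case: ji; apply: val_inj => /=; lia.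
Qed.

Let extV d (v : 'cV['F_2]_d) k :
  (k <= d)%N -> ext (Vmx d.+1 *m v) k = ext v (if k == d then d else d.-1 - k)%N.
Proof.
rewrite leq_eqVlt => /predU1P[->|kd].
  rewrite eqxx !ext_ge // (reindex_inj rev_ord_inj).
  by apply: eq_bigr => i _; rewrite VmxE rev_ordK.
rewrite ltn_eqF // -[k]/(val (Ordinal kd)) ext_lt VmxE -ext_lt /=.
by congr ext; lia.
Qed.

Let extU_lt d (v : 'cV['F_2]_d) k : (k < d)%N ->
  ext (Umx d.+1 *m v) k = ext v (if k == d.-1 then d else d.-2 - k)%N.
Proof.
move=> kd; rewrite -[k]/(val (Ordinal kd)) ext_lt mxE /=.
case: ifP => kd1.
  rewrite ext_ge //; apply: eq_bigr => j _.
  have e : k.+1 == d by lia.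
  by rewrite mxE /= e GRing.mul1r.
have jd : (d.-2 - k < d)%N by lia.
have ke : (k.+1 == d) = false by lia.
rewrite -[(d.-2 - k)%N]/(val (Ordinal jd)) ext_lt (bigD1 (Ordinal jd)) //=.
rewrite big1 ?GRing.addr0 => [|j /eqP ji].
  have e : (k.+1 + (d.-2 - k).+1 == d)%N by lia.
  by rewrite mxE /= ke e GRing.mul1r.
rewrite mxE /= ke; case: eqP => [/= e|_]; last by rewrite GRing.mul0r.
by case: ji; apply: val_inj => /=; lia.
Qed.

Let extU d (v : 'cV['F_2]_d) k : (k <= d)%N ->
  ext (Umx d.+1 *m v) k =
  ext v (if k == d.-1 then d else if k == d then d.-1 else d.-2 - k)%N.
Proof.
case: d v => [|e] v; first by move=> _; rewrite !ext_ge ?big_ord0 //; case: ifP.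
rewrite leq_eqVlt => /predU1P[->|kd]; last by rewrite extU_lt // (ltn_eqF kd).
rewrite ifF ?eqxx /=; last by lia.
rewrite ext_ge // big_ord_recr /= -ext_lt extU_lt //= eqxx ext_ge //.
rewrite [X in _ + X]big_ord_recr /= GRing.addrA.
rewrite (reindex_inj rev_ord_inj) /= -[RHS](GRing.add0r).
rewrite -[e in RHS]/(val (@ord_max e)) ext_lt; congr (_ + _).
rewrite -[RHS](F2_addrr (\sum_i v (widen_ord (leqnSn e) i) 0)); congr (_ + _).
apply: eq_bigr => i _; rewrite -!ext_lt extU_lt /=; last by lia.
have i_lt := ltn_ord i; rewrite ifF /=; last by lia.
by congr ext; lia.
Qed.

Local Ltac lia_if := repeat match goal with
  | |- context[if ?b then _ else _] =>
      lazymatch b with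
      | context[if _ then _ else _] => fail
      | _ => case: (boolP b) => ? /=
      end
  end; lia.

Let mx1_ext d (A : 'M['F_2]_d) :
  (forall (v : 'cV_d) k, (k <= d)%N -> ext (A *m v) k = ext v k) -> A = 1%:M.
Proof.
move=> Aext; apply/matrixP => i j.
have /colP/(_ i) : A *m delta_mx j 0 = delta_mx j (0 : 'I_1).
  by apply: ext_inj; apply: Aext.
by rewrite -colE !mxE eqxx andbT.
Qed.

Lemma Umx_sqr n : Umx n *m Umx n = 1%:M.
Proof.
case: n => [|d]; first by apply/matrixP => -[].
apply: mx1_ext => v k /= kd; rewrite -mulmxA !extU //; last by lia_if.
by congr ext; lia_if.
Qed.

Lemma Vmx_sqr n : Vmx n *m Vmx n = 1%:M.
Proof.
case: n => [|d]; first by apply/matrixP => -[].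
apply: mx1_ext => v k /= kd; rewrite -mulmxA !extV //; last by lia_if.
by congr ext; lia_if.
Qed.

Lemma Umx_unit n : Umx n \in unitmx.
Proof. exact: (mulmx1_unit (Umx_sqr n)).1. Qed.

Lemma Vmx_unit n : Vmx n \in unitmx.
Proof. exact: (mulmx1_unit (Vmx_sqr n)).1. Qed.

Definition U (n : nat) : GL 'F_2 n.-1 := exist _ (Umx n) (Umx_unit n).
Definition V (n : nat) : GL 'F_2 n.-1 := exist _ (Vmx n) (Vmx_unit n).

Lemma U_sqr n : (U n ^+ 2 = 1)%g.
Proof. by apply: val_inj; rewrite /= Umx_sqr. Qed.

Lemma V_sqr n : (V n ^+ 2 = 1)%g.
Proof. by apply: val_inj; rewrite /= Vmx_sqr. Qed.

Lemma UV_expn n : ((U n * V n) ^+ n = 1)%g.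
Proof.
case: n => [//|d]; apply: val_inj; apply: mx1_ext => v k /= kd.
suff UVm m : ext (val ((U d.+1 * V d.+1) ^+ m)%g *m v) k = ext v ((k + m) %% d.+1)%N.
  by rewrite UVm modnDr modn_small.
elim: m v => [|m IH] v; first by rewrite addn0 modn_small // val_GL1 mul1mx.
rewrite expgSr val_GLM -mulmxA IH /= -mulmxA.
have -> : ((k + m.+1) %% d.+1 = ((k + m) %% d.+1).+1 %% d.+1)%N.
  by rewrite addnS -addn1 -[in RHS]addn1 modnDml.
have: ((k + m) %% d.+1 < d.+1)%N by rewrite ltn_mod.
move: ((k + m) %% d.+1)%N => r; rewrite ltnS => rd.
rewrite extU // extV; last by lia_if.
move: rd; rewrite leq_eqVlt => /predU1P[->|rd].
  by rewrite modnn; congr ext; lia_if.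
by rewrite modn_small //; congr ext; lia_if.
Qed.

End MatricesUV.

Section GroupG.
Variable n : nat.

Fact phi_relators r :
  dihedral_relators n r -> free_lift (tnth [tuple U n; V n]) r = 1.
Proof.
case=> [[]|] ->; rewrite gmulfXn ?gmulfM /= !free_lift_gen.
- exact: U_sqr.
- exact: V_sqr.
- exact: UV_expn.
Qed.

Definition phi : {gmorphism dihedral n -> GL 'F_2 n.-1} := pres_lift phi_relators.

Lemma phi_h0 : phi (h0 n) = U n.
Proof. exact: pres_lift_gen. Qed.

Lemma phi_h1 : phi (h1 n) = V n.
Proof. exact: pres_lift_gen. Qed.

Definition G : groupType := semidirect phi.

Definition rho0 : G := (0%R, h0 n).
Definition rho1 : G := (0%R, h1 n).
Definition rho2 : G := ((\col_i (i.+1 == n.-1)%N%:R)%R, h0 n).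

Let x0 : free_group 'I_3 := free_gen (@Ordinal 3 0 isT).
Let x1 : free_group 'I_3 := free_gen (@Ordinal 3 1 isT).
Let x2 : free_group 'I_3 := free_gen (@Ordinal 3 2 isT).

Definition G_relators : set (free_group 'I_3) :=
  ([set x0 ^+ 2; x1 ^+ 2; x2 ^+ 2; (x0 * x2) ^+ 2; (x0 * x1) ^+ n; (x1 * x2) ^+ n]
   `|` [set ((x1 * x2) ^+ k * (x0 * x1) ^+ k) ^+ 2 |
         k in [set k : nat | (1 <= k <= n.-1)%N]])%classic.

End GroupG.

(* Main.v *)
Require Import Defs.
From mathcomp Require Import all_boot.
From HB Require Import structures.
From mathcomp Require Import all_algebra zify boolp classical_sets.

Set Implicit Arguments.
Unset Strict Implicit.
Unset Printing Implicit Defensive.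

Import Algebra.

(** Let r0, r1, r2 satisfy the relators in some group H, and put
    w_k = (r1 r2)^k (r0 r1)^k for 0 <= k <= n. In G the element w_k is the
    translation by the k-th unit vector e_k (with e_0 = e_n = 0), so the
    relators w_k^2 = 1 say that these translations are involutions. The point
    is that they already force the whole structure of G.

    From r0^2 = r1^2 = r2^2 = (r0 r1)^n = (r1 r2)^n = 1 one gets
      r1 w_k r1 = w_{n-k}   and   r2 w_k r0 = w_{n-1-k},
    and with (r0 r2)^2 = 1 the second reads r0 w_k r0 = w_{n-1} w_{n-1-k}.
    These are the formulas V e_k = e_{n-k} and U e_k = e_{n-1} + e_{n-1-k}
    by which the dihedral group acts on F_2^{n-1}.

    The w_k commute with each other. Indeed w_{n-1} w_{n-1-k} is a conjugate of
    the involution w_k, hence an involution, so w_{n-1} commutes with every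
    w_j. Then conjugation by r0 turns the statement that w_i commutes with
    every w_j into the same for w_{n-1-i}, and conjugation by r1 carries it
    from there to w_{i+1}, which allows an induction on i ([transl_commute]).

    Hence a |-> prod_i w_i^{a_i} is a homomorphism from F_2^{n-1} to H that is
    equivariant for the dihedral group, and it extends to a homomorphism
    G -> H with rho_i |-> r_i ([G_universal]). With H the abstract group of the
    presentation, this is a two-sided inverse of the induced homomorphism,
    because both composites fix a generating family. *)

(** * Subgroups and generating sets *)

Section Generation.
Local Open Scope group_scope.
Variables (K : groupType) (S : set K).

Lemma subgroupV x : subgroup S -> S x -> S x^-1.
Proof. by move=> [S1 SF] Sx; rewrite -div1g; apply: SF. Qed.

Lemma subgroupM x y : subgroup S -> S x -> S y -> S (x * y).
Proof.
move=> Ssub Sx Sy; rewrite -[y]invgK; case: (Ssub) => _; apply=> //.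
exact: subgroupV.
Qed.

Lemma subgroupX x k : subgroup S -> S x -> S (x ^+ k).
Proof.
move=> Ssub Sx; elim: k => [|k IH]; first by case: Ssub.
by rewrite expgS; apply: subgroupM.
Qed.

Lemma generates_ind (A : set K) :
  generates A -> subgroup S -> (A `<=` S)%classic -> forall x, S x.
Proof.
move=> gA Ssub AS x; have : smallest (@subgroup K) A x by rewrite gA.
by apply; split.
Qed.

End Generation.

Section Morphisms.
Local Open Scope group_scope.

Lemma eq_gmorphism_gen (K L : groupType) (A : set K) (f g : {gmorphism K -> L}) :
  generates A -> (forall x, A x -> f x = g x) -> f =1 g.
Proof.
move=> gA fg x; pose E := [set x | f x = g x]%classic.
apply: (@generates_ind _ E _ gA) => //; split=> [|y z /= fgy fgz].
  by rewrite /E /= !gmulf1.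
by rewrite /E /= !gmulfM !gmulfV fgy fgz.
Qed.

Lemma pres_gen_generates (X : choiceType) (R : set (free_group X)) :
  generates (range (pres_gen R)).
Proof.
apply/seteqP; split=> // p _ S [Ssub gS].
rewrite -[p]pres_reprK -[pres_repr p]word_reprK.
elim: (word_repr _) => [|[x b] u IH]; first by case: Ssub.
rewrite -cat1s -free_mulE -pres_mulE; apply: (subgroupM Ssub) => //.
have Sx : S (pres_gen R x) by apply: gS; exists x.
case: b => //; have := subgroupV Ssub Sx.
by rewrite [(_)^-1]pres_invE [(_)^-1]free_invE.
Qed.

End Morphisms.

(** * Families that satisfy the relators *)

Section Relators.
Local Open Scope group_scope.

Lemma free_lift_pres_gen (X : choiceType) (R : set (free_group X)) g :
  free_lift (pres_gen R) g = pres_class R g.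
Proof.
rewrite -[g]word_reprK; elim: (word_repr g) => [|[x b] u IH].
  by rewrite -/(free_one X) gmulf1.
rewrite -cat1s -free_mulE gmulfM /= IH -pres_mulE; congr (_ * _).
rewrite free_liftE /word_eval big_seq1; case: b => //=.
by rewrite [(_)^-1]pres_invE [(_)^-1]free_invE.
Qed.

Lemma pres_gen_relators (X : choiceType) (R : set (free_group X)) r :
  R r -> free_lift (pres_gen R) r = 1.
Proof.
move=> Rr; rewrite free_lift_pres_gen; apply/pres_classP.
have [[N1 NF] _] := normal_closureP R; rewrite mulg1 -div1g.
by apply: NF => //; apply: sub_normal_closure.
Qed.

(** Relators are elements of a free group but are used as identities between
    the images of the generators; this equivalence and the next one pass from
    one form to the other. One direction reads off the identities in a presented
    group, the other defines homomorphisms out of it. *)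
Lemma dihedral_relatorsP n (H : groupType) (f : 'I_2 -> H) :
  (forall r, dihedral_relators n r -> free_lift f r = 1) <->
  [/\ f (@Ordinal 2 0 isT) ^+ 2 = 1, f (@Ordinal 2 1 isT) ^+ 2 = 1 &
      (f (@Ordinal 2 0 isT) * f (@Ordinal 2 1 isT)) ^+ n = 1].
Proof.
split=> [fR|[f0 f1 f01] r].
  split; [have := fR (free_gen (@Ordinal 2 0 isT) ^+ 2)
         |have := fR (free_gen (@Ordinal 2 1 isT) ^+ 2)
         |have := fR ((free_gen (@Ordinal 2 0 isT) *
                       free_gen (@Ordinal 2 1 isT)) ^+ n)];
  rewrite gmulfXn ?gmulfM /= !free_lift_gen; apply.
  - by left; left.
  - by left; right.
  - by right.
by case=> [[]|] ->; rewrite gmulfXn ?gmulfM /= !free_lift_gen.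
Qed.

Lemma G_relatorsP n (H : groupType) (f : 'I_3 -> H) :
  let r0 := f (@Ordinal 3 0 isT) in
  let r1 := f (@Ordinal 3 1 isT) in
  let r2 := f (@Ordinal 3 2 isT) in
  (forall r, G_relators n r -> free_lift f r = 1) <->
  [/\ r0 ^+ 2 = 1, r1 ^+ 2 = 1, r2 ^+ 2 = 1 & (r0 * r2) ^+ 2 = 1] /\
  [/\ (r0 * r1) ^+ n = 1, (r1 * r2) ^+ n = 1 &
      forall k, (1 <= k <= n.-1)%N -> ((r1 * r2) ^+ k * (r0 * r1) ^+ k) ^+ 2 = 1].
Proof.
move=> r0 r1 r2; split=> [fR|[[f0 f1 f2 f02] [f01 f12 fk]] r].
  pose x0 := free_gen (@Ordinal 3 0 isT).
  pose x1 := free_gen (@Ordinal 3 1 isT).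
  pose x2 := free_gen (@Ordinal 3 2 isT).
  split; split; [have := fR (x0 ^+ 2) | have := fR (x1 ^+ 2)
    | have := fR (x2 ^+ 2) | have := fR ((x0 * x2) ^+ 2)
    | have := fR ((x0 * x1) ^+ n) | have := fR ((x1 * x2) ^+ n)
    | move=> k kn; have := fR (((x1 * x2) ^+ k * (x0 * x1) ^+ k) ^+ 2)];
  rewrite gmulfXn ?gmulfM ?gmulfXn ?gmulfM /= !free_lift_gen; apply;
  try by left; do ?[by right | left].
  by right; exists k.
by case=> [[[[[[]|]|]|]|] -> | [k kn <-]];
   rewrite gmulfXn ?gmulfM ?gmulfXn ?gmulfM /= !free_lift_gen //; apply: fk.
Qed.

End Relators.

(** * The matrices U and V on unit vectors *)

Section UnitVectors.
Local Open Scope ring_scope.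
Variable n : nat.

(** The index k is 1-based, and the indices 0 and n give the zero vector: this
    makes the action of U and V uniform in k. *)
Definition unit_col k : 'cV['F_2]_n.-1 := \col_i (i.+1 == k)%N%:R.

Lemma unit_colE k : (0 < n)%N -> (k <= n)%N ->
  ((k == 0)%N || (k == n)) /\ unit_col k = 0 \/
  exists2 j : 'I_n.-1, j.+1 = k & unit_col k = delta_mx j 0.
Proof.
move=> n_gt0 kn; have [kE|kE] := boolP ((k == 0)%N || (k == n)).
  left; split=> //; apply/colP => i; rewrite !mxE.
  by case: eqP => // ik; have := ltn_ord i; lia.
right; have jP : (k.-1 < n.-1)%N by lia.
exists (Ordinal jP) => /=; first by lia.
apply/colP => i; rewrite !mxE eqxx andbT -val_eqE /=; congr (_%:R).
by apply/eqP/eqP; lia.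
Qed.

Lemma F2_cases (x : 'F_2) : x = 0 \/ x = 1.
Proof. by case: x => [[|[|m]] //] lt_m; [left | right]; apply: val_inj. Qed.

Lemma F2_col_addrr d (a : 'cV['F_2]_d) : a + a = 0.
Proof.
apply/colP => i; rewrite !mxE.
by case: (F2_cases (a i 0)) => ->; apply: val_inj.
Qed.

Lemma unit_col_ind (Q : 'cV['F_2]_n.-1 -> Prop) :
  Q 0 -> (forall a b, Q a -> Q b -> Q (a + b)) ->
  (forall k, (0 < k < n)%N -> Q (unit_col k)) -> forall a, Q a.
Proof.
move=> Q0 QD Qe a; rewrite [a]matrix_sum_delta; apply: big_ind => // i _.
rewrite big_ord1; case: (F2_cases (a i 0)) => ->; first by rewrite GRing.scale0r.
have i_lt : (i.+1 < n)%N by have := ltn_ord i; lia.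
have [|[]|[j [/val_inj -> <-]]] := @unit_colE i.+1 _ (ltnW i_lt); try lia.
by rewrite GRing.scale1r; apply: Qe.
Qed.

Lemma Vmx_unit_col k : (0 < n)%N -> (k <= n)%N ->
  Vmx n *m unit_col k = unit_col (n - k)%N.
Proof.
move=> n_gt0 kn; have [[/orP k0n ->]|[j jk ->]] := unit_colE n_gt0 kn.
  have [[_ ->]|[j jk]] := unit_colE n_gt0 (leq_subr k n); first exact: mulmx0.
  by have := ltn_ord j; case: k0n => /eqP; lia.
apply/colP => i; rewrite -colE !mxE; congr (_%:R); lia.
Qed.

Lemma Umx_unit_col k : (k < n)%N ->
  Umx n *m unit_col k = unit_col n.-1 + unit_col (n.-1 - k)%N.
Proof.
move=> kn; have n_gt0 : (0 < n)%N by lia.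
have [[/orP k0n ->]|[j jk ->]] := unit_colE n_gt0 (ltnW kn).
  have -> : k = 0%N by case: k0n => /eqP; lia.
  by rewrite mulmx0 subn0 F2_col_addrr.
apply/colP => i; rewrite -colE !mxE; have i_lt := ltn_ord i.
case: eqP => in1.
  have -> : (i.+1 == n.-1 - k)%N = false by lia.
  by rewrite GRing.addr0.
by rewrite GRing.add0r; congr (_%:R); lia.
Qed.

End UnitVectors.

(** * Consequences of the relators *)

Section Translations.
Local Open Scope group_scope.
Variables (H : groupType) (n : nat) (r0 r1 r2 : H).

(** In G this is the translation by the k-th unit vector; see [transl_G]. *)
Definition transl k := (r1 * r2) ^+ k * (r0 * r1) ^+ k.

Hypotheses (r0_sqr : r0 ^+ 2 = 1) (r1_sqr : r1 ^+ 2 = 1) (r2_sqr : r2 ^+ 2 = 1).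
Hypothesis r02_sqr : (r0 * r2) ^+ 2 = 1.
Hypotheses (r01_expn : (r0 * r1) ^+ n = 1) (r12_expn : (r1 * r2) ^+ n = 1).
Hypothesis transl_sqr_mid :
  forall k, (1 <= k <= n.-1)%N -> transl k ^+ 2 = 1.
Hypothesis n_gt0 : (0 < n)%N.

Lemma inv_involution (x : H) : x ^+ 2 = 1 -> x^-1 = x.
Proof. by rewrite expg2 => /mulg1_eq. Qed.

Let r0V := inv_involution r0_sqr.
Let r1V := inv_involution r1_sqr.
Let r2V := inv_involution r2_sqr.

Lemma transl0 : transl 0 = 1.
Proof. by rewrite /transl !expg0 mulg1. Qed.

Lemma transl_n : transl n = 1.
Proof. by rewrite /transl r01_expn r12_expn mulg1. Qed.

(** Both rotations have order dividing n, so that going n - k steps forwards is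
    going k steps backwards. *)
Lemma translB k : (k <= n)%N -> transl (n - k) = (r2 * r1) ^+ k * (r1 * r0) ^+ k.
Proof.
move=> kn; rewrite /transl !expgnFr // r12_expn r01_expn !div1g.
by rewrite -!expVgn !invgM r0V r1V r2V.
Qed.

Lemma transl_conj1 k : (k <= n)%N -> transl k ^ r1 = transl (n - k).
Proof.
move=> kn; rewrite translB // conjMg !conjXg !conjgE r1V.
by rewrite !mulgA -expg2 r1_sqr mul1g -!mulgA -expg2 r1_sqr mulg1.
Qed.

(** The first letter r2 and the last letter r0 of
    w_{n-1-k} = (r2 r1)^{k+1} (r1 r0)^{k+1} can be split off; in the middle
    r1 r1 cancels and leaves w_k. *)
Lemma transl_shift k : (k < n)%N -> r2 * transl k * r0 = transl (n.-1 - k).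
Proof.
move=> kn; have -> : (n.-1 - k)%N = (n - k.+1)%N by lia.
have shift (u v : H) : u * (v * u) ^+ k = (u * v) ^+ k * u.
  elim: k {kn} => [|k IH]; first by rewrite !expg0 mulg1 mul1g.
  by rewrite !expgSr mulgA IH -!mulgA.
rewrite translB // (expgS (r2 * r1)) (expgSr (r1 * r0)) /transl.
have -> : (r1 * r0) ^+ k * (r1 * r0) = r1 * ((r0 * r1) ^+ k * r0).
  by rewrite !mulgA shift.
have -> : r2 * r1 * (r2 * r1) ^+ k = r2 * (r1 * r2) ^+ k * r1.
  by rewrite -!mulgA shift.
by rewrite -!mulgA (mulgA r1 r1) -expg2 r1_sqr mul1g.
Qed.

Lemma transl_last : transl n.-1 = r2 * r0.
Proof. by have := transl_shift n_gt0; rewrite transl0 mulg1 subn0. Qed.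

Lemma transl_sqr k : (k <= n)%N -> transl k ^+ 2 = 1.
Proof.
case: k => [|k] kn; first by rewrite transl0 expg1n.
have [kn1|kn1] := leqP k.+1 n.-1; first exact: transl_sqr_mid.
have -> : k.+1 = n by lia.
by rewrite transl_n expg1n.
Qed.

(** The counterpart of U e_k = e_{n-1} + e_{n-1-k}. *)
Lemma transl_conj0 k :
  (k < n)%N -> transl k ^ r0 = transl n.-1 * transl (n.-1 - k).
Proof.
move=> kn; rewrite -transl_shift // transl_last conjgE r0V !mulgA.
have -> : r2 * r0 = r0 * r2 by rewrite -(inv_involution r02_sqr) invgM r0V r2V.
by rewrite -[_ * r2 * r2]mulgA -expg2 r2_sqr mulg1 -!mulgA.
Qed.

(** The product of w_{n-1} and w_k is conjugate to w_{n-1-k}, hence an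
    involution; two involutions whose product is an involution commute. *)
Lemma transl_last_commute k : (k <= n)%N -> commute (transl n.-1) (transl k).
Proof.
rewrite leq_eqVlt => /predU1P[->|kn]; first by rewrite transl_n; apply: commute1.
have kn1 : (n.-1 - k < n)%N by lia.
have conjE := transl_conj0 kn1; rewrite subKn in conjE; last by lia.
have /inv_involution : (transl n.-1 * transl k) ^+ 2 = 1.
  by rewrite -conjE -conjXg transl_sqr ?conj1g //; lia.
by rewrite invgM !inv_involution ?transl_sqr // ?leq_pred // ltnW.
Qed.

(** Induction on i. Conjugating by r0 moves the index i to n-1-i, up to the
    factor w_{n-1}, which commutes with everything; conjugating by r1 then moves
    n-1-i to i+1. *)
Lemma transl_commute i k :
  (i <= n)%N -> (k <= n)%N -> commute (transl i) (transl k).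
Proof.
elim: i k => [|i IH] k i_n kn; first by rewrite transl0; apply/commute_sym/commute1.
have cJ (x y z : H) : commute x y -> commute (x ^ z) (y ^ z).
  by rewrite /commute -!conjMg => ->.
(* The case of index n - k = n is trivial; otherwise n - k = n-1-(k-1) is
   reached from k - 1 by conjugation by r0. *)
have step : commute (transl (n.-1 - i)) (transl (n - k)).
  have [->|k_gt0] := posnP k.
    by rewrite subn0 transl_n; apply: commute1.
  have kn1 : (k.-1 < n)%N by lia.
  have := cJ _ _ r0 (IH _ (ltnW i_n) (ltnW kn1)).
  rewrite !transl_conj0 //.
  have -> : (n.-1 - k.-1)%N = (n - k)%N by lia.
  set c := transl n.-1; set x := transl _; set y := transl _.
  have cK z : c * (c * z) = z.
    by rewrite mulgA -expg2 transl_sqr ?mul1g // leq_pred.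
  have uncancel u v : commute u c -> commute u (c * v) -> commute u v.
    by move=> uc ucv; rewrite -[v]cK; apply: commuteM.
  have c_comm z : commute z c -> commute (c * z) c.
    by move=> zc; apply/commute_sym/commuteM/commute_sym.
  have cx : commute x c by apply/commute_sym/transl_last_commute; lia.
  have cy : commute y c by apply/commute_sym/transl_last_commute; lia.
  move/(uncancel _ _ (c_comm _ cx))/commute_sym/(uncancel _ _ cy).
  exact: commute_sym.
have := cJ _ _ r1 step; rewrite !transl_conj1 ?leq_subr //; last by lia.
rewrite subKn //; congr (commute (transl _) _); lia.
Qed.

(** * The homomorphism from G given by the relators *)

(** The vector a is the sum of the e_{i+1} over the 0-based i with a_i = 1; the
    exponent is the representative 0 or 1 of a_i. *)
Definition translation (a : 'cV['F_2]_n.-1) : H :=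
  \prod_(i < n.-1) transl i.+1 ^+ a i 0%R.

Lemma translation_unit_col k : (k <= n)%N -> translation (unit_col n k) = transl k.
Proof.
move=> kn; have [[/orP k0n e0]|[j jk ej]] := unit_colE n_gt0 kn.
  rewrite /translation e0 big1 => [|i _]; last by rewrite mxE.
  by case: k0n => /eqP ->; rewrite ?transl0 ?transl_n.
rewrite /translation ej -jk.
rewrite (eq_bigr (fun i : 'I__ => if i == j then transl i.+1 else 1)) => [|i _].
  by rewrite -big_mkcond big_pred1_eq.
by rewrite mxE andbT; case: eqP.
Qed.

Lemma translationD : {morph translation : a b / (a + b)%R >-> a * b}.
Proof.
move=> a b; rewrite /translation -prodgM_commute => [|i j _ _]; last first.
  apply: commuteX2; apply: transl_commute; have := ltn_ord i; have := ltn_ord j; lia.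
apply: eq_bigr => i _; rewrite mxE.
have := transl_sqr (leq_trans (ltn_ord i) (leq_pred n)); rewrite expg2.
by case: (F2_cases (a i 0%R)) (F2_cases (b i 0%R)) => -> [] ->;
   rewrite ?GRing.addr0 ?GRing.add0r ?mulg1 ?mul1g.
Qed.

(** The homomorphism is (a, x) |-> translation a * psi x, where psi maps h0, h1
    to r0, r1. That it is multiplicative amounts to the equivariance of
    [translation], which has to be checked only for h0, h1 and on unit vectors,
    where it is [transl_conj0] and [transl_conj1]. *)
Lemma G_universal : exists g : {gmorphism G n -> H},
  [/\ g (rho0 n) = r0, g (rho1 n) = r1 & g (rho2 n) = r2].
Proof.
have hR : forall r, dihedral_relators n r -> free_lift (tnth [tuple r0; r1]) r = 1.
  exact/dihedral_relatorsP.
pose psi : {gmorphism dihedral n -> H} := pres_lift hR.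
have psi_h0 : psi (h0 n) = r0 by apply: pres_lift_gen.
have psi_h1 : psi (h1 n) = r1 by apply: pres_lift_gen.
have translation0 : translation 0 = 1.
  by apply: (@mulgI _ (translation 0)); rewrite -translationD GRing.addr0 mulg1.
have equivariant x a :
    translation (val (phi n x) *m a)%R * psi x = psi x * translation a.
  pose E := [set x | forall a,
    translation (val (phi n x) *m a)%R * psi x = psi x * translation a]%classic.
  move: a; apply: (generates_ind (S := E) (pres_gen_generates _)).
    split=> [a|y z Ey Ez a]; first by rewrite !gmulf1 mul1mx mul1g mulg1.
    rewrite !gmulfM !gmulfV val_GLM -mulmxA mulgA Ey -!mulgA; congr (_ * _).
    apply: (@mulgI _ (psi z)); rewrite mulVKg mulgA -Ez mulmxA -val_GLM.
    by rewrite mulgV mul1mx mulgK.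
  have gen_equivariant h M r : phi n h = M -> psi h = r -> r ^+ 2 = 1 ->
      (forall k, (0 < k < n)%N ->
        translation (val M *m unit_col n k)%R = transl k ^ r) -> E h.
    move=> phih psih r_sqr Mr; rewrite /E /= phih psih => a.
    elim/unit_col_ind: a => [|a b Ea Eb|k kn].
    - by rewrite mulmx0 translation0 mulg1 mul1g.
    - by rewrite mulmxDr !translationD -mulgA Eb !mulgA Ea.
    rewrite Mr // translation_unit_col; last by lia.
    by rewrite conjgE inv_involution // -!mulgA -expg2 r_sqr mulg1.
  move=> _ [i _ <-]; case: i => [[|[|//]] lt_i].
  - have -> : pres_gen (dihedral_relators n) (Ordinal lt_i) = h0 n.
      by congr pres_gen; apply: val_inj.
    apply: gen_equivariant (phi_h0 n) psi_h0 r0_sqr _ => k kn.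
    rewrite /= Umx_unit_col ?translationD ?translation_unit_col; try lia.
    by rewrite transl_conj0 //; lia.
  - have -> : pres_gen (dihedral_relators n) (Ordinal lt_i) = h1 n.
      by congr pres_gen; apply: val_inj.
    apply: gen_equivariant (phi_h1 n) psi_h1 r1_sqr _ => k kn.
    rewrite /= Vmx_unit_col ?translation_unit_col ?transl_conj1 //; lia.
pose g (y : G n) : H := translation y.1 * psi y.2.
have gM : monoid_morphism g.
  split=> [|[a x] [b y]]; rewrite /g /=; first by rewrite translation0 gmulf1 mulg1.
  by rewrite translationD gmulfM !mulgA -(mulgA (translation a)) equivariant !mulgA.
exists (HB.pack_for {gmorphism G n -> H} g (isUMagmaMorphism.Build _ _ g gM)); split=> /=.
- by rewrite /g /= translation0 mul1g psi_h0.
- by rewrite /g /= translation0 mul1g psi_h1.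
rewrite /g /= psi_h0 -[X in translation X]/(unit_col n n.-1).
rewrite translation_unit_col ?leq_pred // transl_last.
by rewrite -mulgA -expg2 r0_sqr mulg1.
Qed.

End Translations.

(** * The relators in G *)

Section GroupG.
Local Open Scope group_scope.
Variables (n : nat) (n_gt0 : (0 < n)%N).

Lemma G_mulE (a b : 'cV['F_2]_n.-1) (x y : dihedral n) :
  ((a, x) : G n) * ((b, y) : G n) = ((a + val (phi n x) *m b)%R, x * y).
Proof. by []. Qed.

Lemma dihedral_relations :
  [/\ h0 n ^+ 2 = 1, h1 n ^+ 2 = 1 & (h0 n * h1 n) ^+ n = 1].
Proof. exact: (dihedral_relatorsP n _).1 (@pres_gen_relators _ _). Qed.

Lemma expg_dihedral (x : dihedral n) k : ((0%R, x) : G n) ^+ k = (0%R, x ^+ k).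
Proof.
by elim: k => // k IH; rewrite !expgS IH G_mulE mulmx0 GRing.addr0.
Qed.

(** With V e_{n-1} = e_1, one step of the recursion
    w_{k+1} = rho1 rho2 w_k rho0 rho1 replaces the vector e_k by
    e_1 + V U e_k = e_1 + V (e_{n-1} + e_{n-1-k}) = e_{k+1}. *)
Lemma transl_G k : (k <= n)%N ->
  transl (rho0 n) (rho1 n) (rho2 n) k = (unit_col n k, 1) :> G n.
Proof.
have [h0_sqr h1_sqr _] := dihedral_relations.
elim: k => [|k IH] kn.
  have [[_ ->]|[[j j_lt] //]] := unit_colE n_gt0 kn.
  by rewrite /transl !expg0 mulg1.
have r12 : rho1 n * rho2 n = (unit_col n 1%N, h1 n * h0 n).
  rewrite /rho1 /rho2 -/(unit_col n n.-1) G_mulE phi_h1 /= GRing.add0r.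
  by rewrite Vmx_unit_col ?leq_pred //; congr (unit_col _ _, _); lia.
have r01 : rho0 n * rho1 n = (0%R, h0 n * h1 n).
  by rewrite /rho0 /rho1 G_mulE mulmx0 GRing.addr0.
have -> : transl (rho0 n) (rho1 n) (rho2 n) k.+1 =
    (rho1 n * rho2 n) * (transl (rho0 n) (rho1 n) (rho2 n) k * (rho0 n * rho1 n)).
  by rewrite /transl expgS expgSr -!mulgA.
rewrite IH ?(ltnW kn) // r12 r01 (G_mulE (unit_col n k)) mulmx0 GRing.addr0 mul1g.
rewrite G_mulE gmulfM phi_h0 phi_h1; congr (_, _); last first.
  by rewrite -mulgA (mulgA (h0 n)) -expg2 h0_sqr mul1g -expg2.
rewrite val_GLM -mulmxA Umx_unit_col // mulmxDr GRing.addrA.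
rewrite !Vmx_unit_col ?leq_pred //; last by lia.
have -> : (n - n.-1)%N = 1%N by lia.
by rewrite F2_col_addrr GRing.add0r; congr unit_col; lia.
Qed.

Lemma G_relations :
  forall r, G_relators n r ->
    free_lift (tnth [tuple rho0 n; rho1 n; rho2 n]) r = 1.
Proof.
have [h0_sqr h1_sqr h01_expn] := dihedral_relations.
have unit_col_sqr k : ((unit_col n k, 1) : G n) ^+ 2 = 1.
  by rewrite expg2 G_mulE gmulf1 mul1mx F2_col_addrr mulg1.
have unit_col0 : unit_col n 0 = 0%R.
  by have [[]|[[j j_lt] //]] := unit_colE n_gt0 (leq0n n).
have unit_coln : unit_col n n = 0%R.
  by have [[_ ->]|[j jn]] := unit_colE n_gt0 (leqnn n); last by have := ltn_ord j; lia.
have r01 : (rho0 n * rho1 n) ^+ n = 1.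
  by rewrite /rho0 /rho1 G_mulE mulmx0 GRing.addr0 expg_dihedral h01_expn.
have U_last : (Umx n *m unit_col n n.-1 = unit_col n n.-1)%R.
  by rewrite Umx_unit_col ?subnn ?unit_col0 ?GRing.addr0 //; lia.
apply/G_relatorsP; split; split.
- by rewrite expg_dihedral h0_sqr.
- by rewrite expg_dihedral h1_sqr.
- rewrite /rho2 -/(unit_col n n.-1) expg2 G_mulE phi_h0 /= U_last.
  by rewrite F2_col_addrr -expg2 h0_sqr.
- rewrite [X in X ^+ 2](_ : _ = (unit_col n n.-1, 1)) //.
  rewrite /rho0 /rho2 /= -/(unit_col n n.-1) G_mulE phi_h0 /= U_last.
  by rewrite GRing.add0r -expg2 h0_sqr.
- exact: r01.
(* As (rho0 rho1)^n = 1, the left hand side is w_n, the translation by e_n = 0. *)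
- have := transl_G (leqnn n); rewrite /transl r01 mulg1 => ->.
  by rewrite unit_coln.
- move=> k kn; have := @transl_G k; rewrite /transl => -> //; lia.
Qed.

(** The rho_i generate the translations by unit vectors, by [transl_G], and the
    dihedral complement, by rho0 and rho1. *)
Lemma rho_generates : generates (range (tnth [tuple rho0 n; rho1 n; rho2 n])).
Proof.
apply/seteqP; split=> // -[a x] _ S [Ssub rhoS].
have S0 : S (rho0 n) by apply: rhoS; exists (@Ordinal 3 0 isT).
have S1 : S (rho1 n) by apply: rhoS; exists (@Ordinal 3 1 isT).
have S2 : S (rho2 n) by apply: rhoS; exists (@Ordinal 3 2 isT).
have -> : (a, x) = ((a, 1) : G n) * ((0%R, x) : G n).
  by rewrite G_mulE mulmx0 GRing.addr0 mul1g.
apply: (subgroupM Ssub).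
  elim/unit_col_ind: a => [|a b Sa Sb|k kn]; first by case: Ssub.
    by have := subgroupM Ssub Sa Sb; rewrite G_mulE gmulf1 mul1mx mulg1.
  rewrite -transl_G; last by lia.
  by apply: (subgroupM Ssub); apply: (subgroupX _ Ssub); apply: (subgroupM Ssub).
pose E := [set y : dihedral n | S (0%R, y)]%classic.
apply: (generates_ind (S := E) (pres_gen_generates _)).
  split=> [|y z Sy Sz]; first by case: Ssub.
  case: (Ssub) => _ /(_ _ _ Sy Sz); congr S.
  by rewrite [(_)^-1]/(sd_inv _) /sd_inv /= mulmx0 GRing.oppr0 G_mulE mulmx0 GRing.addr0.
move=> _ [i _ <-]; case: i => [[|[|//]] lt_i]; rewrite /E /=.
  by congr S: S0; congr (_, pres_gen _ _); apply: val_inj.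
by congr S: S1; congr (_, pres_gen _ _); apply: val_inj.
Qed.

End GroupG.

Theorem theorem3p4 (n : nat) (hn : 3 <= n) :
  admits_presentation (tnth [tuple rho0 n; rho1 n; rho2 n]) (G_relators n).
Proof.
have n_gt0 : 0 < n by lia.
split; first exact: rho_generates.
have fR := G_relations n_gt0; exists fR.
have [[r0_sqr r1_sqr r2_sqr r02_sqr] [r01_expn r12_expn rk_sqr]] :=
  (G_relatorsP n _).1 (@pres_gen_relators _ (G_relators n)).
have [g [g0 g1 g2]] :=
  G_universal r0_sqr r1_sqr r2_sqr r02_sqr r01_expn r12_expn rk_sqr n_gt0.
have fE := pres_lift_gen fR.
have gE i : g (tnth [tuple rho0 n; rho1 n; rho2 n] i) = pres_gen (G_relators n) i.
  by case: i => [[|[|[|//]]] lt_i]; rewrite (tnth_nth 1%g) /= ?g0 ?g1 ?g2;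
     congr pres_gen; apply: val_inj.
exists g => x.
  apply: (@eq_gmorphism_gen _ _ _ (g \o pres_lift fR) idfun (pres_gen_generates _)).
  by move=> _ [i _ <-] /=; rewrite fE gE.
apply: (@eq_gmorphism_gen _ _ _ (pres_lift fR \o g) idfun (rho_generates n_gt0)).
by move=> _ [i _ <-] /=; rewrite gE fE.
Qed.
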